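(* (a) Let $\mathbf{k}$ be a field and let $p_1,\dots,p_{13}$ be pairwise distinct points of the projective plane $\mathbb{P}^2(\mathbf{k})$ such that each of the following triples is collinear: $\{p_1,p_2,p_3\},\{p_1,p_2,p_{13}\},\{p_1,p_3,p_{13}\},\{p_1,p_4,p_5\},\{p_1,p_6,p_9\},\{p_1,p_7,p_{10}\},\{p_1,p_8,p_{12}\},\{p_2,p_3,p_{13}\},\{p_2,p_4,p_6\},\{p_2,p_5,p_8\},\{p_2,p_{10},p_{11}\},\{p_3,p_4,p_7\},\{p_3,p_5,p_6\},\{p_3,p_8,p_{10}\},\{p_4,p_9,p_{10}\},\{p_5,p_7,p_{11}\},\{p_6,p_7,p_{13}\},\{p_6,p_8,p_{11}\},\{p_6,p_{10},p_{12}\},\{p_7,p_9,p_{12}\}$. Then $p_{11},p_{12},p_{13}$ are collinear. (b) This is not an absolute incidence theorem: there exist a commutative ring $A$ and a $3\times 13$ matrix with entries in $A$ such that the entries of each column generate the unit ideal, for every pair of distinct columns $i\neq j$ the three $2\times2$ minors using columns $i,j$ generate the unit ideal, the $3\times 3$ minor with columns $a,b,c$ vanishes for each of the twenty triples $\{a,b,c\}$ of indices listed in (a), but the $3\times3$ minor with columns $11,12,13$ is nonzero.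
   Context: Points in $\mathbb{P}^2(\mathbf{k})$ correspond to nonzero vectors in $\mathbf{k}^3$ up to scaling; three points are collinear iff the determinant of the $3\times 3$ matrix of their coordinate vectors vanishes. *)

(* Defs.v *)
From HB Require Import structures.
From mathcomp Require Import all_boot all_order all_algebra.

Set Implicit Arguments.
Unset Strict Implicit.
Unset Printing Implicit Defensive.

Import GRing.Theory.
Local Open Scope ring_scope.

(* Points of P^2(k) are given by representatives u : 'cV[k]_3 with u != 0;
   two representatives define the same point iff they are proportional. *)
Definition same_point (k : fieldType) (u v : 'cV[k]_3) : Prop :=
  exists2 c : k, c != 0 & v = c *: u.

Definition collinear (k : fieldType) (u v w : 'cV[k]_3) : Prop :=
  \det (\matrix_(i < 3, j < 3) tnth [tuple u; v; w] j i 0) = 0.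

(* The 1-based label n (1 <= n <= 13) as an element of 'I_13; [inZp] is used
   because, unlike [inord], it computes. *)
Definition lbl (n : nat) : 'I_13 := inZp n.-1.

Definition triples : seq ('I_13 * 'I_13 * 'I_13) :=
  [seq (lbl t.1.1, lbl t.1.2, lbl t.2) | t <-
    [:: (1, 2, 3);   (1, 2, 13);  (1, 3, 13); (1, 4, 5);
        (1, 6, 9);   (1, 7, 10);  (1, 8, 12); (2, 3, 13);
        (2, 4, 6);   (2, 5, 8);   (2, 10, 11); (3, 4, 7);
        (3, 5, 6);   (3, 8, 10);  (4, 9, 10); (5, 7, 11);
        (6, 7, 13);  (6, 8, 11);  (6, 10, 12); (7, 9, 12)]%N].

Definition in_ideal_gen (A : comPzRingType) (n : nat) (x : 'I_n -> A) (a : A)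
  : Prop := exists c : 'I_n -> A, a = \sum_i c i * x i.

Definition generates_unit_ideal (A : comPzRingType) (n : nat) (x : 'I_n -> A)
  : Prop := forall a : A, in_ideal_gen x a.

(* The 2x2 minor of columns i, j on the two rows other than r. *)
Definition minor2 (A : comPzRingType) (m : nat) (M : 'M[A]_(3, m))
    (i j : 'I_m) (r : 'I_3) : A :=
  \det (row' r (colsub (tnth [tuple i; j]) M) : 'M[A]_2).

Definition minor3 (A : comPzRingType) (m : nat) (M : 'M[A]_(3, m))
    (a b c : 'I_m) : A :=
  \det (colsub (tnth [tuple a; b; c]) M).

(* Main.v *)
Require Import Defs.
From HB Require Import structures.
From mathcomp Require Import all_boot all_order all_algebra ring.

Set Implicit Arguments.
Unset Strict Implicit.
Unset Printing Implicit Defensive.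

Import GRing.Theory.
Local Open Scope ring_scope.

(** If [p4] lies on the line through [p1, p2, p3, p13], then all the points do.
    Otherwise that line can be taken as the line at infinity and coordinates
    chosen so that the finite points are [p4 = (0,0)], [p5 = (1,0)],
    [p6 = (0,-1)], [p7 = (t,t)], [p8 = (1,s)], [p9 = (v,-1)], [p10 = (x,t)],
    [p11 = (x,y)], [p12 = (w,s)], while [p13] is the direction [(t,t+1)] and
    [s = t + 1 - x].  With [E = 2x - t - 1], [F = (t-1)x - t^2 - t + 1] and
    [Q = t^2 + 2t - 1], the conclusion amounts to [E (x - t - 1) = 0]. The
    hypotheses give [E F = 0], and [(t-1) E = Q + 2 F] where [t Q] vanishes as
    soon as [F] does: so [E = 0] over a field, but in general [E] is only
    nilpotent.  Over [Z/49], [t = 2] gives [Q = 7], and the nilpotent [E = 28]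
    (that is, [x = 40]) satisfies all the hypotheses. *)

(** * Explicit determinants of sizes 2 and 3 *)

Lemma ord3P (P : 'I_3 -> Prop) : P 0 -> P 1 -> P 2 -> forall i, P i.
Proof.
move=> P0 P1 P2 [[|[|[|//]]] lt_i3].
- by rewrite (_ : Ordinal _ = 0) //; apply: val_inj.
- by rewrite (_ : Ordinal _ = 1) //; apply: val_inj.
- by rewrite (_ : Ordinal _ = 2) //; apply: val_inj.
Qed.

Lemma sum_ord3 (A : nmodType) (F : 'I_3 -> A) : \sum_i F i = F 0 + F 1 + F 2.
Proof.
rewrite !big_ord_recl big_ord0 addr0 addrA.
by congr (F _ + F _ + F _); apply: val_inj.
Qed.

Lemma det_mx2 (A : comPzRingType) (M : 'M[A]_2) :
  \det M = M 0 0 * M 1 1 - M 0 1 * M 1 0.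
Proof.
rewrite (expand_det_row _ 0) !big_ord_recl big_ord0 addr0 /cofactor !det_mx11 !mxE /=.
rewrite expr0 expr1 mul1r mulN1r mulrN.
by congr (M _ _ * M _ _ - M _ _ * M _ _); apply: val_inj.
Qed.

Lemma det_mx3 (A : comPzRingType) (M : 'M[A]_3) :
  \det M = M 0 0 * (M 1 1 * M 2 2 - M 1 2 * M 2 1)
         - M 0 1 * (M 1 0 * M 2 2 - M 1 2 * M 2 0)
         + M 0 2 * (M 1 0 * M 2 1 - M 1 1 * M 2 0).
Proof.
rewrite (expand_det_row _ 0) sum_ord3 /cofactor !det_mx2 !mxE /=.
rewrite expr0 expr1 sqrrN expr1n !mul1r mulN1r mulrN.
do !congr (_ + _); do ?congr (- _); do ?congr (_ * _); do !congr (_ + _);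
  do ?congr (- _); do ?congr (_ * _); by congr (M _ _); apply: val_inj.
Qed.

Definition det3 (k : comPzRingType) (x0 x1 x2 y0 y1 y2 z0 z1 z2 : k) : k :=
  x0 * (y1 * z2 - z1 * y2) - y0 * (x1 * z2 - z1 * x2) + z0 * (x1 * y2 - y1 * x2).

Lemma collinearE (k : fieldType) (u v w : 'cV[k]_3) :
  collinear u v w <->
  det3 (u 0 0) (u 1 0) (u 2 0) (v 0 0) (v 1 0) (v 2 0) (w 0 0) (w 1 0) (w 2 0) = 0.
Proof. by rewrite /collinear det_mx3 !mxE. Qed.

(** * Elimination in affine coordinates *)

Lemma eq_of_diff (R : pzRingType) (a b c d : R) : a - b = c * d -> d = 0 -> a = b.
Proof. by move=> e d0; apply/eqP; rewrite -subr_eq0 e d0 mulr0. Qed.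

(** The equations encode, in order, the collinear triples 3-8-10, 4-9-10, 6-8-11, 5-7-11, 6-10-12
    and 7-9-12. The conclusion makes [p12 - p11 = (w - x, s - y)] parallel to the direction
    [(t, t + 1)] of [p13]. *)
Lemma normal_form_parallel (k : fieldType) (t x v y w s : k) :
  t != 0 -> s = t + 1 - x -> v * t = - x -> y = (s + 1) * x - 1 ->
  y * (t - 1) = t * (x - 1) -> w * (t + 1) = (s + 1) * x ->
  (w - t) * (t + 1) = (t - v) * (s - t) -> (w - x) * (t + 1) = (s - y) * t.
Proof.
move=> t0 -> vt -> e1 ew e2.
have h1 : t ^+ 2 * x - t * x ^+ 2 + (x - 1) ^+ 2 = 0.
  by move/eqP: e1; rewrite -subr_eq0 => /eqP <-; ring.
(* This is [e2] times [t], so that [w * (t + 1)] and [v * t] can be eliminated; only [t] and [x]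
   remain. *)
have h2 : t * ((t + 2 - x) * x - t * (t + 1)) - (x + t ^+ 2) * (1 - x) = 0.
  transitivity (t * ((w - t) * (t + 1) - (t - v) * (t + 1 - x - t))
    - t * (w * (t + 1) - (t + 1 - x + 1) * x)
    - (v * t + x) * (1 - x)); first by ring.
  by rewrite e2 ew vt; ring.
pose E := 2 * x - t - 1; pose F := (t - 1) * x - t ^+ 2 - t + 1.
have EF : E * F = 0.
  transitivity (- ((t ^+ 2 * x - t * x ^+ 2 + (x - 1) ^+ 2)
     + (t * ((t + 2 - x) * x - t * (t + 1)) - (x + t ^+ 2) * (1 - x)))).
    by rewrite /E /F; ring.
  by rewrite h1 h2; ring.
have E0 : E = 0.
  move/eqP: EF; rewrite mulf_eq0 => /orP[/eqP //|/eqP F0].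
  (* At [t = 1], [F] is [-1]; hence [F = 0] makes [t - 1] cancellable. *)
  have t1 : t - 1 != 0.
    apply/eqP => t1; move/eqP: F0; apply/negP.
    rewrite (_ : F = -1 + (t - 1) * (x - t - 2)); last by rewrite /F; ring.
    by rewrite t1 mul0r addr0 oppr_eq0 oner_eq0.
  (* An explicit combination of [h1] and [F] gives [t * Q]. *)
  have Q0 : t * (t ^+ 2 + 2 * t - 1) = 0.
    apply: (eq_of_diff (c := -1) _
      (d := (t - 1) * (t ^+ 2 * x - t * x ^+ 2 + (x - 1) ^+ 2)
      + F * (t * (t + 2) + F))); last by rewrite h1 F0; ring.
    by rewrite /F; ring.
  move/eqP: Q0; rewrite mulf_eq0 (negPf t0) => /eqP Q0.
  apply: (mulfI t1); rewrite mulr0.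
  transitivity (t ^+ 2 + 2 * t - 1 + 2 * F); first by rewrite /E /F; ring.
  by rewrite Q0 F0; ring.
apply: (eq_of_diff (c := 1)
  (d := (w * (t + 1) - (t + 1 - x + 1) * x)
      + (t ^+ 2 * x - t * x ^+ 2 + (x - 1) ^+ 2) - E * (x - t - 1))).
  by rewrite /E; ring.
by rewrite ew h1 E0; ring.
Qed.

(** * Proportionality, spans and projective coordinates *)

Lemma minors_proportional (k : fieldType) (u v : 'cV[k]_3) :
  u != 0 -> v != 0 ->
  (forall i j, u i 0 * v j 0 = u j 0 * v i 0) -> same_point u v.
Proof.
move=> /matrix0Pn[i [j]]; rewrite ord1 => ui /matrix0Pn[i' [j']].
rewrite ord1 => vi' H.
have vE : v = (v i 0 / u i 0) *: u.
  by apply/colP => l; rewrite mxE mulrAC [v i 0 * _]mulrC -H mulrAC mulfV // mul1r.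
exists (v i 0 / u i 0) => //.
by apply: contraNneq vi' => c0; rewrite vE c0 scale0r mxE.
Qed.

(** Distinct points have a nonzero minor on some rows [i], [j]. Cramer's rule there gives the
    coefficients, and the vanishing determinant settles the third row. *)
Lemma collinear_span (k : fieldType) (u v w : 'cV[k]_3) :
  u != 0 -> v != 0 -> ~ same_point u v -> collinear u v w ->
  exists a b : k, w = a *: u + b *: v.
Proof.
move=> u0 v0 nuv /collinearE; rewrite /det3 => d0.
have [i [j m0]] : exists i j, u i 0 * v j 0 - u j 0 * v i 0 != 0.
  have [/existsP[i /existsP[j mij]]|/existsPn nij] :=
    boolP [exists i, exists j, u i 0 * v j 0 - u j 0 * v i 0 != 0].
    by exists i, j.
  case: nuv; apply: minors_proportional => // i j.
  by have /existsPn/(_ j) := nij i; rewrite negbK subr_eq0 => /eqP.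
exists ((w i 0 * v j 0 - w j 0 * v i 0) / (u i 0 * v j 0 - u j 0 * v i 0)).
exists ((u i 0 * w j 0 - u j 0 * w i 0) / (u i 0 * v j 0 - u j 0 * v i 0)).
apply/colP => l; rewrite !mxE; apply: (mulfI m0).
have mK A B (m := u i 0 * v j 0 - u j 0 * v i 0) : m * (A / m * B) = A * B.
  by rewrite mulrA (mulrC m) divfK.
rewrite mulrDr !mK {mK}.
move: i j l m0 d0 {u0 v0 nuv}.
by apply: ord3P; apply: ord3P; apply: ord3P => m0 d0;
  first [ring | apply: (eq_of_diff (c := 1) _ d0); ring
              | apply: (eq_of_diff (c := -1) _ d0); ring].
Qed.

(** Homogeneous coordinates in a frame; [l] absorbs the choice of representative of the point. *)
Definition has_coords (k : fieldType) (e1 e2 e3 p : 'cV[k]_3) (x y z : k) : Prop :=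
  exists2 l : k, l != 0 & p = l *: (x *: e1 + y *: e2 + z *: e3).

(** Multiplicativity of the determinant: the two determinants differ by the scalars [a], [b], [c]
    and the determinant of the frame, all nonzero. *)
Lemma has_coords_collinear (k : fieldType) (e1 e2 e3 u v w : 'cV[k]_3)
    (x0 x1 x2 y0 y1 y2 z0 z1 z2 : k) :
  ~ collinear e1 e2 e3 ->
  has_coords e1 e2 e3 u x0 x1 x2 -> has_coords e1 e2 e3 v y0 y1 y2 ->
  has_coords e1 e2 e3 w z0 z1 z2 ->
  collinear u v w <-> det3 x0 x1 x2 y0 y1 y2 z0 z1 z2 = 0.
Proof.
move=> ne [a a0 ->] [b b0 ->] [c c0 ->]; rewrite collinearE !mxE.
set D := det3 x0 _ _ _ _ _ _ _ _.
pose De := \det (\matrix_(i < 3, j < 3) tnth [tuple e1; e2; e3] j i 0).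
have De0 : De != 0 by apply/eqP.
set lhs := det3 _ _ _ _ _ _ _ _ _.
have -> : lhs = (a * b * c * De) * D.
  by rewrite /lhs /D /De det_mx3 !mxE /det3 /tnth /=; ring.
have abcD : a * b * c * De != 0 by rewrite !mulf_neq0.
by split=> [/eqP|->]; rewrite ?mulr0 // mulf_eq0 (negPf abcD) => /eqP.
Qed.

Lemma has_coords_same (k : fieldType) (e1 e2 e3 u v : 'cV[k]_3) (x y z : k) :
  has_coords e1 e2 e3 u x y z -> has_coords e1 e2 e3 v x y z -> same_point u v.
Proof.
move=> [a a0 ->] [b b0 ->]; exists (b / a); first by rewrite mulf_neq0 ?invr_eq0.
by rewrite scalerA divfK.
Qed.

(** Here [u] is at infinity and [v] is finite. Since [w] is not [u], its coefficient on [v] is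
    nonzero, and dividing by it normalises the last coordinate to 1. *)
Lemma has_coords_affine (k : fieldType) (e1 e2 e3 u v w : 'cV[k]_3) (a b c d : k) :
  u != 0 -> v != 0 -> w != 0 -> ~ same_point u v -> ~ same_point u w ->
  collinear u v w ->
  has_coords e1 e2 e3 u a b 0 -> has_coords e1 e2 e3 v c d 1 ->
  exists t, has_coords e1 e2 e3 w (c + t * a) (d + t * b) 1.
Proof.
move=> u0 v0 w0 nuv nuw /(collinear_span u0 v0 nuv)[r [s wE]] [l l0 uE] [m m0 vE].
have s0 : s != 0.
  apply/eqP => s0; apply: nuw; exists r; last by rewrite wE s0 scale0r addr0.
  by apply: contraNneq w0 => r0; rewrite wE r0 s0 !scale0r addr0.
exists (r * l / (s * m)), (s * m); first by rewrite mulf_neq0.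
rewrite wE uE vE; apply/colP => i; rewrite !mxE; field.
by rewrite m0 s0.
Qed.

Lemma collinear_in_span (k : fieldType) (u v p q r : 'cV[k]_3) (a b c d e f : k) :
  p = a *: u + b *: v -> q = c *: u + d *: v -> r = e *: u + f *: v ->
  collinear p q r.
Proof. by move=> -> -> ->; apply/collinearE; rewrite /det3 !mxE; ring. Qed.

Lemma collinear_span_trans (k : fieldType) (u v p q r : 'cV[k]_3) :
  p != 0 -> q != 0 -> ~ same_point p q ->
  (exists a b : k, p = a *: u + b *: v) ->
  (exists a b : k, q = a *: u + b *: v) ->
  collinear p q r -> exists a b : k, r = a *: u + b *: v.
Proof.
move=> p0 q0 npq [a [b pE]] [c [d qE]] /(collinear_span p0 q0 npq)[e [f ->]].
exists (e * a + f * c), (e * b + f * d).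
by rewrite pE qE; apply/colP => i; rewrite !mxE; ring.
Qed.

(** * The incidence theorem over a field *)

Lemma incidence_field (k : fieldType) (p : 'I_13 -> 'cV[k]_3) :
  (forall i, p i != 0) ->
  (forall i j, i != j -> ~ same_point (p i) (p j)) ->
  (forall a b c, (a, b, c) \in triples -> collinear (p a) (p b) (p c)) ->
  collinear (p (lbl 11)) (p (lbl 12)) (p (lbl 13)).
Proof.
move=> nz dist col.
(* With numeric labels, distinctness and membership in [triples] are decided by computation. *)
pose P n := p (lbl n).
have nP n : P n != 0 by apply: nz.
have dP i j : lbl i != lbl j -> ~ same_point (P i) (P j) by apply: dist.
have cP a b c : (lbl a, lbl b, lbl c) \in triples -> collinear (P a) (P b) (P c).
  exact: col.
rewrite -/(P 11) -/(P 12) -/(P 13); clearbody P => {nz dist col}.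
have [|/eqP nc124] :=
  eqVneq (\det (\matrix_(i < 3, j < 3) tnth [tuple P 1; P 2; P 4] j i 0)) 0.
  (* Degenerate case: a triple with two points on the line [p1 p2] brings in its third point, until
     11, 12 and 13 are reached. *)
  rewrite -/(collinear (P 1) (P 2) (P 4)) => c124.
  have tr i j l : lbl i != lbl j -> (lbl i, lbl j, lbl l) \in triples ->
      (exists a b : k, P i = a *: P 1 + b *: P 2) ->
      (exists a b : k, P j = a *: P 1 + b *: P 2) ->
      exists a b : k, P l = a *: P 1 + b *: P 2.
    by move=> nij /cP cij oi oj; apply: collinear_span_trans oi oj cij => //; apply: dP.
  have o1 : exists a b : k, P 1 = a *: P 1 + b *: P 2.
    by exists 1, 0; rewrite scale0r addr0 scale1r.
  have o2 : exists a b : k, P 2 = a *: P 1 + b *: P 2.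
    by exists 0, 1; rewrite scale0r add0r scale1r.
  have o4 := collinear_span (nP 1) (nP 2) (dP 1 2 isT) c124.
  have o5 : exists a b : k, P 5 = a *: P 1 + b *: P 2 by exact: (tr 1 4 5).
  have o3 : exists a b : k, P 3 = a *: P 1 + b *: P 2 by exact: (tr 1 2 3).
  have o7 : exists a b : k, P 7 = a *: P 1 + b *: P 2 by exact: (tr 3 4 7).
  have o8 : exists a b : k, P 8 = a *: P 1 + b *: P 2 by exact: (tr 2 5 8).
  have o10 : exists a b : k, P 10 = a *: P 1 + b *: P 2 by exact: (tr 1 7 10).
  have [? [? E11]] : exists a b : k, P 11 = a *: P 1 + b *: P 2 by exact: (tr 2 10 11).
  have [? [? E12]] : exists a b : k, P 12 = a *: P 1 + b *: P 2 by exact: (tr 1 8 12).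
  have [? [? E13]] : exists a b : k, P 13 = a *: P 1 + b *: P 2 by exact: (tr 1 2 13).
  exact: collinear_in_span E11 E12 E13.
rewrite -/(collinear (P 1) (P 2) (P 4)) in nc124.
(* Both coefficients are nonzero because the third point differs from the other two. *)
have spn i j l : lbl i != lbl j -> lbl i != lbl l -> lbl j != lbl l ->
    (lbl i, lbl j, lbl l) \in triples ->
    exists a b : k, [/\ a != 0, b != 0 & P l = a *: P i + b *: P j].
  move=> nij nil njl /cP/(collinear_span (nP i) (nP j) (dP i j nij))[a [b E]].
  exists a, b; split=> //; apply/eqP => z0; move: E; rewrite z0 scale0r.
    rewrite add0r => E; apply: (dP j l njl); exists b => //.
    by apply: contraNneq (nP l) => b0; rewrite E b0 scale0r.
  rewrite addr0 => E; apply: (dP i l nil); exists a => //.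
  by apply: contraNneq (nP l) => b0; rewrite E b0 scale0r.
have [a [b [a0 b0 E3]]] := spn 1 2 3 isT isT isT isT.
have [c [d [c0 d0 E5]]] := spn 1 4 5 isT isT isT isT.
have [g [h [g0 h0 E13]]] := spn 1 2 13 isT isT isT isT.
(* The scaling of [P 2] and [P 4] is chosen to give [P 3] and [P 5] the coordinates [(1, 1, 0)] and
   [(1, 0, 1)]. *)
pose R := has_coords (P 1) (b / a *: P 2) (d / c *: P 4).
have ne : ~ collinear (P 1) (b / a *: P 2) (d / c *: P 4).
  have ba0 : b / a != 0 by rewrite mulf_neq0 ?invr_eq0.
  have dc0 : d / c != 0 by rewrite mulf_neq0 ?invr_eq0.
  move=> /collinearE e0; apply: nc124; apply/collinearE; move: e0.
  rewrite !mxE => e0; apply: (mulfI (mulf_neq0 ba0 dc0)); rewrite mulr0 -e0.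
  by rewrite /det3; ring.
have R1 : R (P 1) 1 0 0.
  by exists 1; rewrite ?oner_eq0 // !scale0r !addr0 !scale1r.
have R2 : R (P 2) 0 1 0.
  exists (a / b); first by rewrite mulf_neq0 ?invr_eq0.
  by apply/colP => i; rewrite !mxE; field; rewrite a0 b0 c0.
have R3 : R (P 3) 1 1 0.
  by exists a => //; rewrite E3; apply/colP => i; rewrite !mxE; field; rewrite c0 a0.
have R4 : R (P 4) 0 0 1.
  exists (c / d); first by rewrite mulf_neq0 ?invr_eq0.
  by apply/colP => i; rewrite !mxE; field; rewrite ?a0 ?b0 ?c0 ?d0.
have R5 : R (P 5) 1 0 1.
  by exists c => //; rewrite E5; apply/colP => i; rewrite !mxE; field; rewrite ?c0 ?a0.
have [g' [h' R13]] : exists g h, R (P 13) g h 0.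
  exists g, (h * a / b), 1; rewrite ?oner_eq0 //.
  by rewrite E13; apply/colP => i; rewrite !mxE; field; rewrite ?c0 ?a0 ?b0.
move: R13 {g h g0 h0 E13}; move: g' h' => g h R13.
have aff i j l x y z w : lbl i != lbl j -> lbl i != lbl l ->
    (lbl i, lbl j, lbl l) \in triples -> R (P i) x y 0 -> R (P j) z w 1 ->
    exists t, R (P l) (z + t * x) (w + t * y) 1.
  move=> nij nil /cP cijl; apply: has_coords_affine => //; exact: dP.
have D i j l x0 x1 x2 y0 y1 y2 z0 z1 z2 : (lbl i, lbl j, lbl l) \in triples ->
    R (P i) x0 x1 x2 -> R (P j) y0 y1 y2 -> R (P l) z0 z1 z2 ->
    det3 x0 x1 x2 y0 y1 y2 z0 z1 z2 = 0.
  by move=> /cP cijl Ri Rj Rl; apply/(has_coords_collinear ne Ri Rj Rl).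
have [t6 R6] := aff 2 4 6 _ _ _ _ isT isT isT R2 R4.
(* [p6] is where the lines [p2 p4] and [p3 p5] meet. *)
have R6' : R (P 6) 0 (-1) 1.
  move: R6; rewrite mulr0 add0r mulr1 add0r => R6.
  have d6 := D 3 5 6 _ _ _ _ _ _ _ _ _ isT R3 R5 R6.
  suff <- : t6 = -1 by [].
  by apply: (eq_of_diff (c := -1) _ d6); rewrite /det3; ring.
have [t R7] := aff 3 4 7 _ _ _ _ isT isT isT R3 R4.
rewrite !(mulr1, add0r) in R7.
have t0 : t != 0.
  by apply/eqP => t0; apply: (dP 4 7) => //; rewrite t0 in R7; apply: has_coords_same R4 R7.
have [s R8] := aff 2 5 8 _ _ _ _ isT isT isT R2 R5.
rewrite !(mulr1, mulr0, add0r, addr0) in R8.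
have [v R9] := aff 1 6 9 _ _ _ _ isT isT isT R1 R6'.
rewrite !(mulr1, mulr0, add0r, addr0) in R9.
have [r R10] := aff 1 7 10 _ _ _ _ isT isT isT R1 R7.
rewrite !(mulr1, mulr0, add0r, addr0) in R10.
move: R10; set x := t + r => R10.
have [q R11] := aff 2 10 11 _ _ _ _ isT isT isT R2 R10.
rewrite !(mulr1, mulr0, add0r, addr0) in R11.
move: R11; set y := t + q => R11.
have [w' R12] := aff 1 8 12 _ _ _ _ isT isT isT R1 R8.
rewrite !(mulr1, mulr0, add0r, addr0) in R12.
move: R12; set w := 1 + w' => R12.
have d1 := D 3 8 10 _ _ _ _ _ _ _ _ _ isT R3 R8 R10.
have d2 := D 4 9 10 _ _ _ _ _ _ _ _ _ isT R4 R9 R10.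
have d3 := D 5 7 11 _ _ _ _ _ _ _ _ _ isT R5 R7 R11.
have d4 := D 6 7 13 _ _ _ _ _ _ _ _ _ isT R6' R7 R13.
have d5 := D 6 8 11 _ _ _ _ _ _ _ _ _ isT R6' R8 R11.
have d6 := D 6 10 12 _ _ _ _ _ _ _ _ _ isT R6' R10 R12.
have d7 := D 7 9 12 _ _ _ _ _ _ _ _ _ isT R7 R9 R12.
apply/(has_coords_collinear ne R11 R12 R13).
clearbody x y w; rewrite /det3 in d1 d2 d3 d4 d5 d6 d7 *.
have xs : s = t + 1 - x by apply: (eq_of_diff (c := 1) _ d1); ring.
have vt : v * t = - x by apply: (eq_of_diff (c := 1) _ d2); ring.
have yE : y = (s + 1) * x - 1 by apply: (eq_of_diff (c := 1) _ d5); ring.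
have e1 : y * (t - 1) = t * (x - 1) by apply: (eq_of_diff (c := 1) _ d3); ring.
have ew : w * (t + 1) = (s + 1) * x by apply: (eq_of_diff (c := -1) _ d6); ring.
have e2 : (w - t) * (t + 1) = (t - v) * (s - t).
  by apply: (eq_of_diff (c := 1) _ d7); ring.
have key := normal_form_parallel t0 xs vt yE e1 ew e2.
(* Times [t], the determinant splits into a multiple of [key] and a multiple of
   [t * h - g * (t + 1)], which [d4] kills: [p13] has direction [(t, t + 1)]. *)
apply: (mulfI t0); rewrite mulr0.
apply: (eq_of_diff (c := 1)
  (d := g * ((w - x) * (t + 1) - (s - y) * t)
      + (w - x) * (t * h - g * (t + 1)))).
  by ring.
rewrite key subrr mulr0 add0r (_ : t * h - g * (t + 1) = 0) ?mulr0 //.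
by apply: (eq_of_diff (c := 1) _ d4); ring.
Qed.

(** * The counterexample modulo 49 *)

Lemma generates_unit_ideal_unit (A : comUnitRingType) (n : nat) (x : 'I_n -> A) (r : 'I_n) :
  x r \is a GRing.unit -> generates_unit_ideal x.
Proof.
move=> xr a; exists (fun i => if i == r then a / x r else 0).
rewrite (bigD1 r) //= eqxx divrK // big1 ?addr0 // => i /negPf ->.
by rewrite mul0r.
Qed.

(* The normal form above with [t = 2] and [x = 40] modulo 49. *)
Definition cex_entry (r j : nat) : 'Z_49 :=
  inZp (nth 0 (nth [::]
    [:: [:: 1; 0; 1; 0; 1;  0; 2;  1; 29; 40; 40; 10; 2];
        [:: 0; 1; 1; 0; 0; 48; 2; 12; 48;  2; 29; 12; 3];
        [:: 0; 0; 0; 1; 1;  1; 1;  1;  1;  1;  1;  1; 0]] r) j)%N.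

Definition cex_mx : 'M['Z_49 : comPzRingType]_(3, 13) :=
  \matrix_(r, j) cex_entry r j.

Lemma cex_minor2 (i j : 'I_13) (r : 'I_3) :
  minor2 cex_mx i j r = cex_entry (bump r 0) i * cex_entry (bump r 1) j
                      - cex_entry (bump r 0) j * cex_entry (bump r 1) i.
Proof. by rewrite /minor2 det_mx2 !mxE. Qed.

Lemma cex_minor3 (a b c : 'I_13) :
  minor3 cex_mx a b c =
    det3 (cex_entry 0 a) (cex_entry 1 a) (cex_entry 2 a)
         (cex_entry 0 b) (cex_entry 1 b) (cex_entry 2 b)
         (cex_entry 0 c) (cex_entry 1 c) (cex_entry 2 c).
Proof. by rewrite /minor3 det_mx3 !mxE /det3; ring. Qed.

Lemma cex_columns_unit (j : 'I_13) :
  generates_unit_ideal (fun r : 'I_3 => cex_mx r j).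
Proof.
(* As Z/49 is local, a family generates the unit ideal exactly when it contains a unit, so a finite
   search for units suffices. *)
have chk : all (fun j => has (fun r => cex_entry r j \is a GRing.unit) (iota 0 3))
               (iota 0 13) by vm_compute.
have /hasP[r] : has (fun r => cex_entry r j \is a GRing.unit) (iota 0 3).
  by apply: (allP chk); rewrite mem_iota ltn_ord.
rewrite mem_iota => ltr3 ur.
by apply: (@generates_unit_ideal_unit 'Z_49 3 _ (Ordinal (ltr3 : r < 3)%N)); rewrite mxE.
Qed.

Lemma cex_pairs_unit (i j : 'I_13) : i != j -> generates_unit_ideal (minor2 cex_mx i j).
Proof.
move=> nij.
have chk : all (fun i => all (fun j => (i == j) || has (fun r =>
    cex_entry (bump r 0) i * cex_entry (bump r 1) j
    - cex_entry (bump r 0) j * cex_entry (bump r 1) i \is a GRing.unit) (iota 0 3))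
  (iota 0 13)) (iota 0 13) by vm_compute.
have := allP (allP chk i _) j _; rewrite !mem_iota !ltn_ord => /(_ isT isT).
rewrite (negPf (nij : i != j :> nat)) => /hasP[r].
rewrite mem_iota => ltr3 ur.
apply: (@generates_unit_ideal_unit 'Z_49 3 _ (Ordinal (ltr3 : r < 3)%N)).
by rewrite cex_minor2.
Qed.

Lemma cex_triples (a b c : 'I_13) : (a, b, c) \in triples -> minor3 cex_mx a b c = 0.
Proof.
move=> abc; rewrite cex_minor3; apply/eqP.
have chk : all (fun t : 'I_13 * 'I_13 * 'I_13 =>
    det3 (cex_entry 0 t.1.1) (cex_entry 1 t.1.1) (cex_entry 2 t.1.1)
         (cex_entry 0 t.1.2) (cex_entry 1 t.1.2) (cex_entry 2 t.1.2)
         (cex_entry 0 t.2) (cex_entry 1 t.2) (cex_entry 2 t.2) == 0) triples.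
  by vm_compute.
exact: (allP chk _ abc).
Qed.

(** The minor is -7 modulo 49: nonzero, but zero modulo 7, in accordance with the theorem over the
    field Z/7. *)
Lemma cex_conclusion_fails : minor3 cex_mx (lbl 11) (lbl 12) (lbl 13) != 0.
Proof. by rewrite cex_minor3; vm_compute. Qed.

Theorem theorem1p6 :
  (forall (k : fieldType) (p : 'I_13 -> 'cV[k]_3),
     (forall i, p i != 0) ->
     (forall i j, i != j -> ~ same_point (p i) (p j)) ->
     (forall a b c, (a, b, c) \in triples -> collinear (p a) (p b) (p c)) ->
     collinear (p (lbl 11)) (p (lbl 12)) (p (lbl 13)))
  /\
  (exists (A : comPzRingType) (M : 'M[A]_(3, 13)),
     [/\ forall j, generates_unit_ideal (fun r : 'I_3 => M r j),
         forall i j, i != j -> generates_unit_ideal (minor2 M i j),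
         forall a b c, (a, b, c) \in triples -> minor3 M a b c = 0
       & minor3 M (lbl 11) (lbl 12) (lbl 13) != 0]).
Proof.
split; first exact: incidence_field.
exists 'Z_49, cex_mx; split.
- exact: cex_columns_unit.
- exact: cex_pairs_unit.
- exact: cex_triples.
- exact: cex_conclusion_fails.
Qed.
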